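(* Let $k \geq 3$. There exist marked groups $\Gamma_k$ and $\Delta_k$ whose Cayley graphs are isomorphic (as graphs) such that (i) $\chi_B(F(2^{\Gamma_k})) = \chi(F(2^{\Gamma_k})) = \chi(F(2^{\Delta_k})) = \chi(\mathrm{Cay}(\Gamma_k)) = \chi(\mathrm{Cay}(\Delta_k)) = k$, and (ii) $\chi_B(F(2^{\Delta_k})) = k+1$.
   Context: A marked group is a pair $(\Gamma,S)$ where $\Gamma$ is a finitely generated group and $S\subset\Gamma$ is a finite symmetric generating set with $\mathrm{id}\notin S$. If $\Gamma$ acts freely by Borel automorphisms on a standard Borel space $X$, the graph $G(S,a)$ on $X$ joins distinct $x,y$ iff $s\cdot x=y$ for some $s\in S$. The Cayley graph $\mathrm{Cay}(\Gamma)$ is this graph for the left multiplication action of $\Gamma$ on itself. The left shift action of $\Gamma$ on $2^\Gamma$ (product topology) is $(g\cdot x)(h)=x(g^{-1}h)$; its free part is $F(2^\Gamma)=\{x\in 2^\Gamma : g\cdot x\neq x \text{ for all } g\neq \mathrm{id}\}$, and the shift graph, also denoted $F(2^\Gamma)$, is the graph $G(S,a)$ for the shift action restricted to $F(2^\Gamma)$. For a graph $G$, $\chi(G)$ is its chromatic number (least $k$ admitting a $k$-coloring, i.e. a map sending adjacent vertices to distinct colors); for a Borel graph on a standard Borel space, $\chi_B(G)$ is the least $k$ such that $G$ admits a Borel $k$-coloring. *)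

(* Defs.v *)
From HB Require Import structures.
From mathcomp Require Import all_boot.
From mathcomp Require Import boolp classical_sets functions cardinality.
From mathcomp Require Import topology measurable_structure.

Set Implicit Arguments.
Unset Strict Implicit.
Unset Printing Implicit Defensive.

Local Open Scope classical_set_scope.
Local Open Scope group_scope.

Record graph (V : Type) := Graph {
  adj :> V -> V -> Prop;
  adj_sym : forall x y, adj x y -> adj y x;
  adj_irr : forall x, ~ adj x x
}.

Definition graph_iso (V W : Type) (G : graph V) (H : graph W) : Prop :=
  exists2 f : V -> W, bijective f & forall x y, G x y <-> H (f x) (f y).

Definition coloring (V : Type) (G : graph V) (k : nat) (c : V -> 'I_k) : Prop :=
  forall x y, G x y -> c x <> c y.

(* The finite set of colors is discrete, so all of its subsets are Borel. *)
Definition borel_map (T : topologicalType) (k : nat) (c : T -> 'I_k) : Prop :=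
  forall A : set 'I_k, <<s @open T >> (c @^-1` A).

Definition colorable (V : Type) (G : graph V) (k : nat) : Prop :=
  exists c : V -> 'I_k, coloring G c.

Definition borel_colorable (T : topologicalType) (G : graph T) (k : nat) : Prop :=
  exists2 c : T -> 'I_k, coloring G c & borel_map c.

Definition is_least (P : nat -> Prop) (k : nat) : Prop :=
  P k /\ forall j, P j -> (k <= j)%N.

Definition chromatic_number (V : Type) (G : graph V) (k : nat) : Prop :=
  is_least (colorable G) k.

Definition borel_chromatic_number (T : topologicalType) (G : graph T) (k : nat)
  : Prop := is_least (borel_colorable G) k.

Record marked_group := MarkedGroup {
  mg_group :> groupType;
  gens : set mg_group;
  gens_finite : finite_set gens;
  gens_sym : forall s, gens s -> gens s^-1;
  gens_neq1 : ~ gens 1;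
  gens_generate : forall H : {pred mg_group},
    group_closed H -> gens `<=` [set` H] -> forall g, g \in H
}.

Record group_action (Gam : groupType) (X : Type) := GroupAction {
  act :> Gam -> X -> X;
  act1 : forall x, act 1 x = x;
  actM : forall g h x, act (g * h) x = act g (act h x)
}.

Section ActionGraph.
Variables (Gam : marked_group) (X : Type) (a : group_action Gam X).

Definition action_adj (x y : X) : Prop :=
  x <> y /\ exists2 s, gens s & a s x = y.

Lemma action_adj_sym x y : action_adj x y -> action_adj y x.
Proof.
move=> [xy [s Ss sxy]]; split; first exact: nesym.
by exists s^-1; [exact: gens_sym | rewrite -sxy -actM mulVg act1].
Qed.

Lemma action_adj_irr x : ~ action_adj x x.
Proof. by case. Qed.

Definition action_graph : graph X := Graph action_adj_sym action_adj_irr.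

End ActionGraph.

Definition left_mult (Gam : groupType) : group_action Gam Gam :=
  @GroupAction Gam Gam (fun g x => g * x) (@mul1g Gam)
    (fun g h x => esym (mulgA g h x)).

Definition Cay (Gam : marked_group) : graph Gam := action_graph (left_mult Gam).

Section Shift.
Variable Gam : groupType.

Notation X := (prod_topology (fun _ : Gam => bool)).

Definition shift_fun (g : Gam) (x : X) : X := fun h => x (g^-1 * h).

Lemma shift_fun1 x : shift_fun 1 x = x.
Proof. by apply/funext => h; rewrite /shift_fun invg1 mul1g. Qed.

Lemma shift_funM g h x : shift_fun (g * h) x = shift_fun g (shift_fun h x).
Proof. by apply/funext => k; rewrite /shift_fun invgM mulgA. Qed.

Definition shift : group_action Gam X := GroupAction shift_fun1 shift_funM.

Definition free_part : set X := [set x | forall g : Gam, g <> 1 -> shift g x <> x].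

Lemma shift_free g x : free_part x -> free_part (shift g x).
Proof.
move=> Fx h h1 e; apply: (Fx (g^-1 * h * g)).
  move=> e1; apply: h1.
  have -> : h = g * (g^-1 * h * g) * g^-1.
    by rewrite !mulgA mulgV mul1g -mulgA mulgV mulg1.
  by rewrite e1 mulg1 mulgV.
by rewrite !actM e -actM mulVg act1.
Qed.

(* As a type, [free_part] carries the library's subspace topology. *)
Definition free_shift_fun (g : Gam) (x : free_part) : free_part :=
  exist _ (shift g (val x)) (mem_set (@shift_free g _ (set_mem (valP x)))).

Lemma free_shift_fun1 x : free_shift_fun 1 x = x.
Proof. by apply: val_inj; exact: act1. Qed.

Lemma free_shift_funM g h x :
  free_shift_fun (g * h) x = free_shift_fun g (free_shift_fun h x).
Proof. by apply: val_inj; exact: actM. Qed.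

Definition free_shift : group_action Gam free_part :=
  GroupAction free_shift_fun1 free_shift_funM.

End Shift.

Arguments free_part Gam : clear implicits.

Definition shift_graph (Gam : marked_group) : graph (free_part Gam) :=
  action_graph (free_shift Gam).

(* Main.v *)
(* Both groups are extensions of Z = <t> by the cyclic group <a> of order k, with t
   commuting with a in Gam and inverting it in Del; besides the nontrivial powers of a
   the generators are the a^j t with j <> 0, 1 and their inverses. An a-orbit is a
   k-clique, and in a k-coloring of it and of its image under t, the color of a point
   must reappear at one of the two non-adjacent positions j = 0, 1; this leaves only
   two choices for the whole level. Hence a k-coloring transports the cyclic order of the
   colors along t, and in Del this order is reversed by t with respect to a: a Borel
   k-coloring would give a Borel set A with t A equal to its complement, which
   contradicts the Baire property. In Gam the phase of the coloring may advance by one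
   from a level to the next, and in Del one spare color allows any two colorings of
   distant levels to be joined by changing one vertex per level; in both cases the
   coloring is built between the points of a Borel maximal separated set of markers. *)
From HB Require Import structures.
From mathcomp Require Import all_boot all_order all_algebra zify ring.
From mathcomp Require Import boolp classical_sets functions cardinality reals.
From mathcomp Require Import topology measurable_structure.
Require Import Defs.

Set Implicit Arguments.
Unset Strict Implicit.
Unset Printing Implicit Defensive.

Import Order.TTheory GRing.Theory.

Local Open Scope classical_set_scope.
Local Open Scope group_scope.

#[local] Arguments act : simpl never.

Section Actions.
Variables (G : groupType) (X : Type) (a : group_action G X).

Lemma actK g : cancel (a g) (a g^-1).
Proof. by move=> x; rewrite -actM mulVg act1. Qed.

Lemma actVK g : cancel (a g^-1) (a g).
Proof. by move=> x; rewrite -actM mulgV act1. Qed.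

End Actions.

Lemma countable_subset T (A : set T) : countable [set: T] -> countable A.
Proof. exact/sub_countable/subset_card_le/subsetT. Qed.

Lemma countable_setTX T U :
  countable [set: T] -> countable [set: U] -> countable [set: T * U].
Proof. by move=> cT cU; rewrite -setXTT; exact: countableX. Qed.

Lemma exists_minimum T (f : T -> int) (P : set T) (b : int) : P !=set0 ->
  (forall x, P x -> (b <= f x)%R) -> exists2 x, P x & forall y, P y -> (f x <= f y)%R.
Proof.
move=> [x0 Px0] Pb; have [|_ [[x Px <-] x_min]] :=
    @nat_has_minimum [set `|f x - b|%N | x in P].
  by exists `|f x0 - b|%N, x0.
exists x => // y Py; have : (`|f x - b| <= `|f y - b|)%N by apply: x_min; exists y.
by have := Pb x Px; have := Pb y Py; lia.
Qed.

(** * Borel sets *)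

Definition borel (T : topologicalType) : set (set T) := <<s @open T >>.

Section Borel.
Variable T : topologicalType.
Implicit Types A B : set T.

Lemma borel_open A : open A -> borel A.
Proof. exact: sub_sigma_algebra. Qed.

Lemma borelC A : borel A -> borel (~` A).
Proof. by move=> bA; rewrite -setTD; exact: sigma_algebraCD. Qed.

Lemma borel_bigcup I (D : set I) (F : I -> set T) : countable D ->
  (forall i, D i -> borel (F i)) -> borel (\bigcup_(i in D) F i).
Proof.
move=> /pfcard_geP[->|[f]] bF; first by rewrite bigcup_set0; exact: sigma_algebra0.
have -> : \bigcup_(i in D) F i = \bigcup_n F (f n).
  apply/seteqP; split=> [x [i Di Fx]|x [n _ Fx]]; last by exists (f n); [exact: funS|].
  by have [n _ fn] := 'surj_f Di; exists n; rewrite ?fn.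
by apply: sigma_algebra_bigcup => n; apply: bF; exact: funS.
Qed.

Lemma borel_bigcap I (D : set I) (F : I -> set T) : countable D ->
  (forall i, D i -> borel (F i)) -> borel (\bigcap_(i in D) F i).
Proof.
move=> cD bF; rewrite -[X in borel X]setCK setC_bigcap; apply: borelC.
by apply: borel_bigcup => // i Di; apply: borelC; exact: bF.
Qed.

Lemma borelU A B : borel A -> borel B -> borel (A `|` B).
Proof. by move=> bA bB; rewrite -bigcup2inE; apply: borel_bigcup => [|[|[|]]]. Qed.

Lemma borelI A B : borel A -> borel B -> borel (A `&` B).
Proof. by move=> bA bB; rewrite -bigcap2inE; apply: borel_bigcap => [|[|[|]]]. Qed.

Lemma borel_cst (P : Prop) : borel [set _ : T | P].
Proof.
apply: borel_open; have [p|np] := pselect P.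
  by rewrite (_ : mkset _ = setT); [exact: openT|apply/seteqP; split].
by rewrite (_ : mkset _ = set0); [exact: open0|apply/seteqP; split].
Qed.

End Borel.

Lemma borel_preimage (T U : topologicalType) (f : T -> U) (A : set U) :
  continuous f -> borel A -> borel (f @^-1` A).
Proof.
move=> /continuousP fc; apply: (@smallest_sub _ _ _ [set A | borel (f @^-1` A)]).
  split=> /= [|B bB|F bF].
  - by rewrite preimage_set0; exact: sigma_algebra0.
  - by rewrite setTD preimage_setC; exact: borelC.
  - by rewrite preimage_bigcup; exact: borel_bigcup.
by move=> O /fc; exact: borel_open.
Qed.

Lemma borel_trace (T : topologicalType) (S : set T) (A : set S) :
  borel A -> exists2 B : set T, borel B & A = val @^-1` B.
Proof.
have traces := sigma_algebra_preimage (setT : set S) val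
  (smallest_sigma_algebra setT (@open T)).
move=> /(smallest_sub traces)[|B bB <-]; last by exists B; rewrite ?setTI.
by move=> _ [O oO <-]; exists O; [exact: borel_open|rewrite setTI].
Qed.

(** * Baire category *)

Section BaireCategory.
Variable T : topologicalType.
Implicit Types A B U : set T.

Definition comeager A : Prop := exists2 O : nat -> set T,
  (forall n, open (O n) /\ dense (O n)) & \bigcap_n O n `<=` A.

Definition baire_property A : Prop :=
  exists2 U, open U & comeager [set x | A x <-> U x].

Definition baire_space : Prop := forall A, comeager A -> dense A.

Lemma comeagerS A B : A `<=` B -> comeager A -> comeager B.
Proof. by move=> AB [O odO OA]; exists O => // x /OA/AB. Qed.

Lemma open_dense_comeager A : open A -> dense A -> comeager A.
Proof. by move=> oA dA; exists (fun=> A) => // x /(_ 0%N I). Qed.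

Lemma comeagerT : comeager setT.
Proof. by apply: open_dense_comeager; [exact: openT|move=> O O0 _; rewrite setIT]. Qed.

Lemma comeager_bigcap_nat (A : nat -> set T) :
  (forall n, comeager (A n)) -> comeager (\bigcap_n A n).
Proof.
move=> cA; have /choice[O OP] n : exists O : nat -> set T,
    (forall k, open (O k) /\ dense (O k)) /\ \bigcap_k O k `<=` A n.
  by have [O] := cA n; exists O.
exists (fun n => if unpickle n is Some (i, k) then O i k else setT).
  move=> n; case: unpickle => [[i k]|]; first exact: (OP i).1.
  by split; [exact: openT|move=> V V0 _; rewrite setIT].
by move=> x Ox n _; apply: (OP n).2 => k _; have := Ox (pickle (n, k)) I; rewrite pickleK.
Qed.

Lemma comeager_bigcap I (D : set I) (A : I -> set T) : countable D ->
  (forall i, D i -> comeager (A i)) -> comeager (\bigcap_(i in D) A i).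
Proof.
move=> /pfcard_geP[->|[f]] cA; first by rewrite bigcap_set0; exact: comeagerT.
have: comeager (\bigcap_n A (f n)).
  by apply: comeager_bigcap_nat => n; apply: cA; exact: funS.
by apply: comeagerS => x Ax i /('surj_f)[n _ <-]; exact: Ax.
Qed.

Lemma comeagerI A B : comeager A -> comeager B -> comeager (A `&` B).
Proof.
move=> cA cB; rewrite -bigcap2E; apply: comeager_bigcap_nat => -[|[|n]] //=.
exact: comeagerT.
Qed.

Lemma open_baire_property U : open U -> baire_property U.
Proof. by move=> oU; exists U => //; apply: comeagerS comeagerT. Qed.

Lemma open_boundary_comeager U : open U -> comeager (U `|` ~` closure U).
Proof.
move=> oU; apply: open_dense_comeager.
  by apply: openU => //; exact/closed_openC/closed_closure.
move=> V [x Vx] oV; have [[y [Vy Uy]]|VU] := pselect (V `&` U !=set0).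
  by exists y; split=> //; left.
exists x; split=> //; right => /(_ V (open_nbhs_nbhs (conj oV Vx))) UV.
by apply: VU; rewrite setIC.
Qed.

Lemma baire_propertyC A : baire_property A -> baire_property (~` A).
Proof.
move=> [U oU AU]; exists (~` closure U); first exact/closed_openC/closed_closure.
apply: comeagerS (comeagerI AU (open_boundary_comeager oU)).
move=> x [/= [AUx UAx] [Ux|nUx]]; split=> //.
- by move=> nAx; case: nAx; exact: UAx.
- by move=> nUx; case: nUx; exact: subset_closure.
- by move=> _ /AUx/subset_closure.
Qed.

Lemma baire_property_bigcup (A : nat -> set T) :
  (forall n, baire_property (A n)) -> baire_property (\bigcup_n A n).
Proof.
move=> bA; have /choice[U UP] n : exists U, open U /\ comeager [set x | A n x <-> U x].
  by have [U] := bA n; exists U.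
exists (\bigcup_n U n); first by apply: bigcup_open => n _; exact: (UP n).1.
apply: comeagerS (comeager_bigcap_nat (fun n => (UP n).2)) => x AU.
by split=> -[n _ /(AU n I)]; exists n.
Qed.

Lemma borel_baire_property A : borel A -> baire_property A.
Proof.
apply: smallest_sub; last exact: open_baire_property.
split; first exact/open_baire_property/open0.
  by move=> A'; rewrite setTD; exact: baire_propertyC.
exact: baire_property_bigcup.
Qed.

End BaireCategory.

Lemma comeager_preimage (T U : topologicalType) (f : T -> U) (A : set U) :
  continuous f -> (forall O, open O -> open (f @` O)) ->
  comeager A -> comeager (f @^-1` A).
Proof.
move=> /continuousP fc fo [O odO OA]; exists (fun n => f @^-1` O n).
  move=> n; split; first exact/fc/(odO n).1.
  move=> V [x Vx] oV; have [|_ [[y Vy <-] Oy]] := (odO n).2 (f @` V) _ (fo _ oV).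
    by exists (f x), x.
  by exists y.
by move=> x Ox; apply: OA => n _; exact: Ox.
Qed.

Lemma compact_nested_closure (T : topologicalType) (V : nat -> set T) :
  compact [set: T] -> (forall n, V n.+1 `<=` V n) -> (forall n, V n !=set0) ->
  \bigcap_n closure (V n) !=set0.
Proof.
move=> cT VS V0.
have V_anti : {homo V : m n / (m <= n)%N >-> n `<=` m}.
  by apply: homo_leq => [A //|B A C BA CB|//]; exact: subset_trans CB BA.
have properV : ProperFilter (filter_from setT V).
  apply: filter_from_proper => [|n _]; last exact: V0.
  apply: filter_from_filter; first by exists 0%N.
  move=> m n _ _; exists (maxn m n) => // x Vx.
  by split; apply: V_anti Vx; [exact: leq_maxl|exact: leq_maxr].
have [|x [_ xV]] := cT _ properV; first by exists 0%N.
by exists x => n _ B xB; apply: xV => //; exists n.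
Qed.

Lemma compact_shrink_open (T : topologicalType) (V : set T) :
  hausdorff_space T -> compact [set: T] -> open V -> V !=set0 ->
  exists W, [/\ open W, W !=set0 & closure W `<=` V].
Proof.
move=> hT cT oV [x Vx]; have [|W Wx clW] := @compact_regular T x setT hT cT filterT V.
  exact: open_nbhs_nbhs.
exists W°; split; [exact: open_interior|by exists x|].
exact: subset_trans (closureS (@interior_subset _ W)) clW.
Qed.

Theorem compact_baire (T : topologicalType) :
  hausdorff_space T -> compact [set: T] -> baire_space T.
Proof.
move=> hT cT A [O odO OA] U U0 oU.
have /choice[shrink shrinkP] (nV : nat * set T) : exists W, open nV.2 -> nV.2 !=set0 ->
    [/\ open W, W !=set0 & closure W `<=` nV.2 `&` O nV.1].
  case: nV => n V /=; have [[oV V0]|nV] := pselect (open V /\ V !=set0); last first.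
    by exists V => oV V0; case: nV.
  have [oO dO] := odO n; have [//||W] := @compact_shrink_open T (V `&` O n) hT cT.
  - exact: openI.
  - exact: dO.
  - by exists W.
pose V := fix V n := if n is n'.+1 then shrink (n', V n') else U.
have oV0 n : open (V n) /\ V n !=set0.
  by elim: n => [//|n [oVn Vn0]]; have [] := shrinkP (n, V n) oVn Vn0.
have VS n : closure (V n.+1) `<=` V n `&` O n.
  by have [_ _] := shrinkP (n, V n) (oV0 n).1 (oV0 n).2.
have [n x /subset_closure/VS[]//|n|x Vx] := compact_nested_closure cT (V := V).
  exact: (oV0 n).2.
exists x; split; first by have [] := VS 0%N x (Vx 1%N I).
by apply: OA => n _; have [] := VS n x (Vx n.+1 I).
Qed.

(* A set with the Baire property agrees generically with an open set, which either is
   generically empty or contains generically all points of a nonempty open set [V]; a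
   generic point of [V `&` f @^-1` V] then sees the same value of [A] at [x] and [f x]. *)
Lemma baire_property_not_flipped (T : topologicalType) (A : set T) :
  [set: T] !=set0 -> baire_space T -> baire_property A ->
  ~ (forall V, open V -> V !=set0 -> exists f : T -> T,
      [/\ continuous f, forall O, open O -> open (f @` O),
          V `&` f @^-1` V !=set0 & comeager [set x | A (f x) <-> ~ A x]]).
Proof.
move=> T0 baire [U oU AU] flips.
have [V [oV V0 VU]] : exists V,
    [/\ open V, V !=set0 & forall x y, V x -> V y -> U x -> U y].
  have [U0|nU] := pselect (U !=set0); first by exists U.
  exists setT; split=> //; first exact: openT.
  by move=> x y _ _ Ux; case: nU; exists x.
have [f [fc fo V2 fA]] := flips V oV V0.
have [|x [[Vx Vfx] [[/= xU fxU] xA]]] := baire _ (comeagerI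
    (comeagerI AU (comeager_preimage fc fo AU)) fA) _ V2.
  by apply: openI => //; move/continuousP: fc; exact.
have same : A x <-> A (f x) by rewrite xU fxU; split; exact: VU.
by move: xA => /=; tauto.
Qed.

Section ProductTopology.
Variables (I : eqType) (K : I -> topologicalType).

Lemma continuous_prod (T : topologicalType) (f : T -> prod_topology K) :
  (forall i, continuous (fun x => f x i)) -> continuous f.
Proof.
move=> fc x; apply/cvg_sup => i V [_ [[W oW <-] Wfx] WV]; apply: filterS WV _.
by apply: fc; exact: open_nbhs_nbhs.
Qed.

Lemma open_prod_finite_support (O : set (prod_topology K)) x : open O -> O x ->
  exists F : seq I, forall y : prod_topology K, {in F, forall i, y i = x i} -> O y.
Proof.
move=> oO Ox.
pose agree (F : seq I) := [set y : prod_topology K | {in F, forall i, y i = x i}].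
have agreeF : Filter (filter_from setT agree).
  apply: filter_from_filter; first by exists [::].
  move=> E F _ _; exists (E ++ F) => // y yx; split=> i iEF; apply: yx.
    by rewrite mem_cat iEF.
  by rewrite mem_cat iEF orbT.
have: filter_from setT agree --> x.
  apply/cvg_sup => i V [_ [[W oW <-] Wx] WV]; exists [:: i] => // y yx.
  by apply: WV; rewrite /preimage /= (yx i) // mem_head.
by move=> /(_ O (open_nbhs_nbhs (conj oO Ox)))[F _ FO]; exists F.
Qed.

End ProductTopology.

(** * The shift space *)

Section ShiftTopology.
Variable G : groupType.
Notation X := (prod_topology (fun _ : G => bool)).

Lemma open_coord (g : G) (b : bool) : open [set x : X | x g = b].
Proof.
apply: (@open_comp _ _ (fun x : X => x g) [set b]); last exact: discrete_open.
by move=> x _; exact: (@proj_continuous G (fun=> bool) g).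
Qed.

Lemma shiftE (g h : G) (x : X) : shift G g x h = x (g^-1 * h).
Proof. by []. Qed.

Lemma shift_continuous (g : G) : continuous (shift G g).
Proof.
by apply: continuous_prod => h; exact: (@proj_continuous G (fun=> bool) (g^-1 * h)).
Qed.

Lemma shift_open (g : G) (O : set X) : open O -> open (shift G g @` O).
Proof.
have /continuousP shift_preim := @shift_continuous g^-1 => oO.
rewrite (_ : _ @` O = shift G g^-1 @^-1` O); first exact: shift_preim.
apply/seteqP; split=> [_ [x Ox <-]|x Ox]; first by rewrite /preimage /mkset actK.
by exists (shift G g^-1 x); rewrite ?actVK.
Qed.

Lemma shift_space_baire : baire_space X.
Proof.
apply: compact_baire.
  by apply: hausdorff_product => g; exact: discrete_hausdorff.
have := @tychonoff G (fun=> bool) (fun=> setT) (fun=> bool_compact).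
by congr compact; apply/seteqP; split.
Qed.

Lemma shift_mixing (U : set X) : open U -> U !=set0 -> exists F : seq G,
  forall g, {in F, forall h, g * h \notin F} -> U `&` shift G g @^-1` U !=set0.
Proof.
move=> oU [x Ux]; have [F FU] := open_prod_finite_support oU Ux.
exists F => g gF; exists (fun u => if u \in F then x u else x (g * u)); split.
  by apply: FU => h hF; rewrite hF.
apply: FU => h hF; rewrite shiftE /= mulVKg; case: ifP => // /gF.
by rewrite mulVKg hF.
Qed.

Lemma free_shift_continuous (g : G) : continuous (free_shift G g).
Proof.
apply/continuousP => _ [O oO <-]; exists (shift G g @^-1` O) => //.
by have /continuousP := @shift_continuous g; exact.
Qed.

Lemma borel_free_shift (g : G) (A : set (free_part G)) :
  borel A -> borel (free_shift G g @^-1` A).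
Proof. by apply: borel_preimage; exact: free_shift_continuous. Qed.

Lemma borel_free_coord (g : G) (b : bool) : borel [set x : free_part G | val x g = b].
Proof. by apply: borel_open; exists [set x : X | x g = b] => //; exact: open_coord. Qed.

Lemma moved_open (g : G) : open [set x : X | shift G g x <> x].
Proof.
rewrite (_ : mkset _ = \bigcup_h \bigcup_b
    ([set x : X | x (g^-1 * h) = b] `&` [set x : X | x h = ~~ b])).
  apply: bigcup_open => h _; apply: bigcup_open => b _.
  by apply: openI; exact: open_coord.
apply/seteqP; split=> x; last first.
  by move=> [h _ [b _ [/= xgh xh]]] /(congr1 (@^~ h)); rewrite shiftE xgh xh; case: (b).
move=> /= gx; have /existsNP[h xh] : ~ (x \o *%g g^-1 =1 x) by move=> /funext.
exists h => //; exists (x (g^-1 * h)) => //; split=> //=.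
by move: xh => /=; case: (x _) (x h) => -[].
Qed.

Hypothesis G_infinite : infinite_set [set: G].

Lemma moved_dense (g : G) : g <> 1 -> dense [set x : X | shift G g x <> x].
Proof.
move=> g1 U [x Ux] oU; have [F FU] := open_prod_finite_support oU Ux.
have [h [_ /negP hF]] := infinite_setN0 (infinite_setD G_infinite (finite_seq F)).
have ghh : g^-1 * h != h.
  by apply/eqP => /(canRL (mulgK h)); rewrite mulgV => /eqP; rewrite invg_eq1 => /eqP.
exists (fun u => if u == h then ~~ x (g^-1 * h) else x u); split; last first.
  by move=> /(congr1 (@^~ h)); rewrite shiftE /= eqxx (negPf ghh); case: (x _).
by apply: FU => u uF; case: eqP => // uh; rewrite -uh uF in hF.
Qed.

Hypothesis G_countable : countable [set: G].

Lemma free_part_comeager : comeager (free_part G : set X).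
Proof.
have: comeager (\bigcap_(g in [set~ 1 : G]) [set x : X | shift G g x <> x]).
  apply: comeager_bigcap => [|g g1]; first exact: countable_subset.
  by apply: open_dense_comeager; [exact: moved_open|exact: moved_dense].
by apply: comeagerS => x xF g g1; exact: xF.
Qed.

Lemma free_part_nonempty : inhabited (free_part G).
Proof.
have [||x [_ xF]] := shift_space_baire free_part_comeager (O := setT).
- by exists (fun=> true).
- exact: openT.
- by split; exact: (exist _ x (mem_set xF)).
Qed.

Lemma free_part_borel_not_flipped (A : set (free_part G)) : borel A ->
  ~ (forall F : seq G, exists2 g, {in F, forall h, g * h \notin F} &
      forall x, A (free_shift G g x) <-> ~ A x).
Proof.
move=> /borel_trace[B /borel_baire_property bB ->] flips.
apply: (baire_property_not_flipped _ shift_space_baire bB) => [|V oV V0].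
  by exists (fun=> true).
have [F FV] := shift_mixing oV V0; have [g gF gB] := flips F.
exists (shift G g); split; [exact: shift_continuous|exact: shift_open|exact: FV|].
apply: comeagerS free_part_comeager => x xF.
exact: gB (exist _ x (mem_set xF)).
Qed.

End ShiftTopology.

Definition infinite_order (G : groupType) (t : G) : Prop :=
  injective (fun n : nat => t ^+ n).

Section InfiniteOrder.
Variables (G : groupType) (t : G).
Hypothesis G_countable : countable [set: G].
Hypothesis t_infinite : infinite_order t.

Lemma infinite_order_infinite_set : infinite_set [set: G].
Proof.
move=> Gfin; apply: infinite_nat.
by apply: (finite_preimage _ Gfin) => m n _ _; exact: t_infinite.
Qed.

Lemma infinite_order_odd_power_notin (F : seq G) : exists2 n, odd n & t ^+ n \notin F.
Proof.
have finF : finite_set [set n | t ^+ n.*2.+1 \in F].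
  apply: finite_preimage (finite_seq F) => m n _ _ /t_infinite.
  by move=> [/double_inj].
have [n [_ /negP nF]] := infinite_setN0 (infinite_setD infinite_nat finF).
by exists n.*2.+1 => //=; rewrite odd_double.
Qed.

Theorem infinite_order_borel_not_flipped (A : set (free_part G)) : borel A ->
  ~ (forall x, A (free_shift G t x) <-> ~ A x).
Proof.
move=> bA tA; apply: (free_part_borel_not_flipped infinite_order_infinite_set
    G_countable bA) => F.
have tnA n x : A (free_shift G (t ^+ n) x) <-> (if odd n then ~ A x else A x).
  elim: n => [|n IHn]; first by rewrite expg0 act1.
  by rewrite expgS actM tA IHn /=; case: (odd n); rewrite /= ?not_notE.
have [n on tnF] := infinite_order_odd_power_notin [seq g * h^-1 | g <- F, h <- F].
exists (t ^+ n) => [h hF|x]; last by rewrite tnA on.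
by apply: contra tnF => tnhF; rewrite -(mulgK h (t ^+ n)); exact: allpairs_f.
Qed.

End InfiniteOrder.

(** * Colorings of free actions *)

Lemma eq_chromatic_number (V W : Type) (G : graph V) (H : graph W) k :
  (forall j, colorable G j <-> colorable H j) ->
  chromatic_number G k -> chromatic_number H k.
Proof. by move=> GH [Gk Gmin]; split=> [|j /GH/Gmin//]; exact/GH. Qed.

Lemma graph_iso_chromatic_number (V W : Type) (G : graph V) (H : graph W) k :
  graph_iso G H -> chromatic_number G k -> chromatic_number H k.
Proof.
move=> [f [g fK gK] fP]; apply: eq_chromatic_number => j; split=> -[c cP].
  by exists (c \o g) => x y xy; apply: cP; apply/fP; rewrite !gK.
by exists (c \o f) => x y xy; apply: cP; exact/fP.
Qed.

Lemma borel_colorableW (T : topologicalType) (G : graph T) k :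
  borel_colorable G k -> colorable G k.
Proof. by move=> [c cP _]; exists c. Qed.

Definition free_action (G : groupType) X (a : group_action G X) : Prop :=
  forall x, injective (a^~ x).

Lemma free_shift_free (G : groupType) : free_action (free_shift G).
Proof.
move=> x g h /= ghx; apply: contrapT => gh.
have ghN1 : h^-1 * g <> 1.
  by move=> /(canRL (mulKg _)); rewrite invgK mulg1.
apply: (set_mem (valP x) _ ghN1).
by have := congr1 (free_shift G h^-1) ghx; rewrite -actM actK => /(congr1 val).
Qed.

Lemma left_mult_free (G : groupType) : free_action (left_mult G).
Proof. by move=> x g h /mulIg. Qed.

Section FreeAction.
Variables (Gam : marked_group) (X : Type) (a : group_action Gam X).
Hypothesis a_free : free_action a.

Lemma free_action_graphE x y :
  action_graph a x y <-> exists2 s, gens s & a s x = y.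
Proof.
split=> [[]//|[s Ss sxy]]; split; last by exists s.
rewrite -sxy -[X in X <> _](act1 a) => /a_free s1.
by apply: (@gens_neq1 Gam); rewrite {1}s1.
Qed.

End FreeAction.

Lemma CayE (Gam : marked_group) (g h : Gam) :
  Cay Gam g h <-> exists2 s, gens s & s * g = h.
Proof. exact/free_action_graphE/left_mult_free. Qed.

Section FreeActionColoring.
Variables (Gam : marked_group) (X : Type) (a : group_action Gam X).
Hypothesis a_free : free_action a.

Lemma free_action_coloring k (c : X -> 'I_k) x :
  coloring (action_graph a) c -> coloring (Cay Gam) (c \o a^~ x).
Proof.
move=> cP g h /CayE[s Ss <-]; apply: cP.
by apply/(free_action_graphE a_free); exists s => //=; rewrite actM.
Qed.

Lemma free_action_orbit_section : inhabited X -> exists gam : X -> Gam,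
  forall s x, gam (a s x) = s * gam x.
Proof.
move=> [x0]; pose orbit x := [set a g x | g in setT].
have orbit_act s x : orbit (a s x) = orbit x.
  apply/seteqP; split=> _ [g _ <-].
    by exists (g * s); rewrite ?actM.
  by exists (g * s^-1); rewrite // actM actK.
have /choice[r rP] (P : set X) : exists y, P !=set0 -> P y.
  by have [[y Py]|P0] := pselect (P !=set0); [exists y|exists x0].
have /choice[gam gamP] x : exists g, a g (r (orbit x)) = x.
  have [|g _ gx] := rP (orbit x); first by exists (a 1 x), 1.
  by exists g^-1; rewrite -gx actK.
exists gam => s x; apply: (a_free (x := r (orbit x))).
by rewrite actM gamP -{1}(orbit_act s) gamP.
Qed.

Lemma free_action_colorable k : inhabited X ->
  colorable (action_graph a) k <-> colorable (Cay Gam) k.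
Proof.
move=> X0; split=> -[c cP].
  by have [x] := X0; exists (c \o a^~ x); exact: free_action_coloring.
have [gam gamM] := free_action_orbit_section X0; exists (c \o gam).
move=> x y /(free_action_graphE a_free)[s Ss <-]; apply: cP; rewrite gamM.
by apply/CayE; exists s.
Qed.

Lemma free_action_chromatic_number k : inhabited X ->
  chromatic_number (Cay Gam) k -> chromatic_number (action_graph a) k.
Proof.
move=> X0; apply: eq_chromatic_number => j; apply: iff_sym.
exact: free_action_colorable.
Qed.

End FreeActionColoring.

(** * Borel maximal independent sets *)

Section BorelMaximalIndependent.
Variables (T : topologicalType) (G : graph T).
Implicit Types A M : set T.

Definition independent A : Prop := forall x y, A x -> A y -> ~ G x y.

Definition neighbors A : set T := [set x | exists2 y, G x y & A y].

Hypothesis neighbors_borel : forall A, borel A -> borel (neighbors A).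

Section Greedy.
Variable B : nat -> set T.
Hypothesis B_borel : forall n, borel (B n).
Hypothesis B_independent : forall n, independent (B n).

Fixpoint greedy n : set T :=
  if n is n'.+1 then greedy n' `|` (B n' `\` neighbors (greedy n')) else set0.

Lemma greedy_borel n : borel (greedy n).
Proof.
elim: n => [|n IHn] /=; first exact: sigma_algebra0.
by apply: borelU => //; apply: borelI => //; apply: borelC; exact: neighbors_borel.
Qed.

Lemma greedy_homo : {homo greedy : m n / (m <= n)%N >-> m `<=` n}.
Proof.
apply: homo_leq => [A //|D A C AD DC|n x xn]; first exact: subset_trans AD DC.
by left.
Qed.

Lemma greedy_independent n : independent (greedy n).
Proof.
elim: n => [//|n IHn] x y [xn|[Bx xN]] [yn|[By yN]] xy.
- exact: IHn xn yn xy.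
- by apply: yN; exists x => //; exact: adj_sym.
- by apply: xN; exists y.
- exact: B_independent Bx By xy.
Qed.

End Greedy.

(* Kechris, Solecki and Todorcevic. *)
Theorem borel_maximal_independent (B : set (set T)) : countable B ->
  (forall A, B A -> borel A /\ independent A) -> \bigcup_(A in B) A = setT ->
  exists M, [/\ borel M, independent M & forall x, M x \/ neighbors M x].
Proof.
move=> /pfcard_geP[->|[f]] BP Bcover.
  exists set0; split=> // [|x]; first exact: sigma_algebra0.
  by have [A] : (\bigcup_(A in set0) A) x by rewrite Bcover.
have fP n : borel (f n) /\ independent (f n) by apply: BP; exact: funS.
exists (\bigcup_n greedy f n); split.
- by apply: borel_bigcup => // n _; apply: greedy_borel => k; exact: (fP k).1.
- move=> x y [m _ xm] [n _ yn].
  apply: (greedy_independent (fun k => (fP k).2) (n := maxn m n)).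
    exact: greedy_homo (leq_maxl m n) _ xm.
  exact: greedy_homo (leq_maxr m n) _ yn.
- move=> x; have [_ /('surj_f)[n _ <-] fx] : (\bigcup_(A in B) A) x by rewrite Bcover.
  have [[y xy yn]|xN] := pselect (neighbors (greedy f n) x).
    by right; exists y => //; exists n.
  by left; exists n.+1 => //; right.
Qed.

End BorelMaximalIndependent.

Section FreeShiftMarkers.
Variable G : groupType.
Hypothesis G_countable : countable [set: G].

Definition cylinder (P : set (G * bool)) : set (free_part G) :=
  [set x | forall g b, P (g, b) -> val x g = b].

Lemma cylinder_borel (P : set (G * bool)) : borel (cylinder P).
Proof.
rewrite (_ : cylinder P = \bigcap_(gb in P) [set x : free_part G | val x gb.1 = gb.2]).
  apply: borel_bigcap => [|gb _]; last exact: borel_free_coord.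
  by apply: countable_subset; exact: countable_setTX.
by apply/seteqP; split=> x xP; [move=> [g b]|move=> g b]; exact: xP.
Qed.

Variable H : set G.
Hypothesis H_finite : finite_set H.
Hypothesis H_sym : forall h, H h -> H h^-1.
Hypothesis H_neq1 : ~ H 1.

Definition displacement (x y : free_part G) : Prop :=
  exists2 h, H h & free_shift G h x = y.

Lemma displacement_sym x y : displacement x y -> displacement y x.
Proof. by move=> [h Hh <-]; exists h^-1; [exact: H_sym|exact: actK]. Qed.

Lemma displacement_irr x : ~ displacement x x.
Proof.
move=> [h Hh]; rewrite -[X in _ = X](act1 (free_shift G)) => /free_shift_free h1.
by apply: H_neq1; rewrite -h1.
Qed.

Definition displacement_graph : graph (free_part G) :=
  Graph displacement_sym displacement_irr.

Lemma displacement_neighbors_borel (A : set (free_part G)) :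
  borel A -> borel (neighbors displacement_graph A).
Proof.
move=> bA; rewrite (_ : neighbors _ A = \bigcup_(h in H) free_shift G h @^-1` A).
  apply: borel_bigcup => [|h _]; last exact: borel_free_shift.
  exact: finite_set_countable.
apply/seteqP; split=> x; first by move=> [_ [h Hh <-] Ax]; exists h.
by move=> [h Hh Ax]; exists (free_shift G h x) => //; exists h.
Qed.

Definition displaced_cylinder (P : set (G * bool)) : set (free_part G) :=
  cylinder P `&` \bigcap_(h in H) ~` (free_shift G h @^-1` cylinder P).

Lemma displaced_cylinder_borel P : borel (displaced_cylinder P).
Proof.
apply: borelI; first exact: cylinder_borel.
apply: borel_bigcap => [|h _]; first exact: finite_set_countable.
by apply: borelC; apply: borel_free_shift; exact: cylinder_borel.
Qed.

Lemma displaced_cylinder_independent P :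
  independent displacement_graph (displaced_cylinder P).
Proof.
move=> x y [_ xP] [yP _] [h Hh hx].
by apply: (xP h Hh); rewrite /preimage /mkset hx.
Qed.

Lemma displaced_cylinder_cover (x : free_part G) :
  exists2 P, finite_set P & displaced_cylinder P x.
Proof.
have /choice[g gP] h : exists g, H h -> val x (h^-1 * g) <> val x g.
  have [Hh|nHh] := pselect (H h); last by exists 1.
  apply: contrapT => /forallNP hx; apply: (@displacement_irr x); exists h => //.
  by apply: val_inj; apply/funext => g; apply: contrapT => xg; apply: (hx g).
exists [set (g h, val x (g h)) | h in H]; first exact: finite_image.
split=> [u b [h _ [<- <-]] //|h Hh hx]; apply: (gP h Hh).
by apply: (hx (g h) (val x (g h))); exists h.
Qed.

Theorem free_shift_borel_markers : exists M : set (free_part G), [/\ borel M,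
  forall h x, H h -> M x -> ~ M (free_shift G h x) &
  forall x, M x \/ exists2 h, H h & M (free_shift G h x)].
Proof.
pose B := [set displaced_cylinder P | P in [set P | finite_set P]].
have [|_ [P _ <-]||M [bM Mindep Mmax]] :=
    borel_maximal_independent displacement_neighbors_borel (B := B).
- apply: sub_countable (card_image_le _ _) _.
  rewrite (_ : mkset _ = [set P : set (G * bool) | P `<=` setT /\ finite_set P]).
    by apply: countable_finite_subset; exact: countable_setTX.
  by apply/seteqP; split=> // P /= [].
- by split; [exact: displaced_cylinder_borel|exact: displaced_cylinder_independent].
- apply/seteqP; split=> // x _; have [P finP xP] := displaced_cylinder_cover x.
  by exists (displaced_cylinder P) => //; exists P.
exists M; split=> // [h x Hh Mx Mhx|x]; first by apply: Mindep Mx Mhx _; exists h.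
have [Mx|[_ [h Hh <-] Mhx]] := Mmax x; first by left.
by right; exists h.
Qed.

End FreeShiftMarkers.

(** * Groups with a level *)

Record level_map (G : groupType) := LevelMap {
  level :> G -> int;
  levelM : {morph level : g h / g * h >-> (g + h)%R};
  level_surj : forall n, exists g, level g = n;
  level_kernel_finite : finite_set [set g | level g = 0%R]
}.

Section Level.
Variables (G : groupType) (level : level_map G).

Lemma level1 : level 1 = 0%R.
Proof. by apply: (addrI (level 1)); rewrite -levelM mulg1 addr0. Qed.

Lemma levelV g : level g^-1 = (- level g)%R.
Proof. by apply: (addrI (level g)); rewrite -levelM mulgV subrr level1. Qed.

Lemma level_fiber_finite n : finite_set [set g | level g = n].
Proof.
have [t tn] := level_surj level n.
apply: sub_finite_set (finite_image ( *%g^~ t) (level_kernel_finite level)) => g /= gn.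
by exists (g * t^-1); rewrite ?mulgVK //= levelM levelV gn tn subrr.
Qed.

Lemma level_ball_finite N : finite_set [set g | (`|level g| <= N)%N].
Proof.
have -> : [set g | (`|level g| <= N)%N] =
    \bigcup_(k < N.+1) ([set g | level g = Posz k] `|` [set g | level g = (- Posz k)%R]).
  apply/seteqP; split=> [g gN|g [k /= kN []] ->]; [|lia|lia].
  by exists `|level g|%N => //=; lia.
by apply: bigcup_finite => // k _; rewrite finite_setU; split; exact: level_fiber_finite.
Qed.

Lemma level_countable : countable [set: G].
Proof.
have -> : [set: G] = \bigcup_n [set g | level g = n].
  by apply/seteqP; split=> // g; exists (level g).
apply: bigcup_countable => [|n _]; first exact: countableP.
exact/finite_set_countable/level_fiber_finite.
Qed.

Section Markers.
Variable N : nat.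

Definition separated (M : set (free_part G)) : Prop := forall x g h,
  M (free_shift G g x) -> M (free_shift G h x) -> (`|level h - level g| <= N)%N -> g = h.

Definition syndetic (M : set (free_part G)) : Prop :=
  forall x, exists2 g, (`|level g| <= N)%N & M (free_shift G g x).

Lemma level_borel_markers : exists M, [/\ borel M, separated M & syndetic M].
Proof.
pose H := [set g | (`|level g| <= N)%N] `\ 1.
have [|||M [bM Mindep Mmax]] := @free_shift_borel_markers G level_countable H.
- exact/finite_setD/level_ball_finite.
- move=> h [/= hN h1]; split; first by rewrite /= levelV abszN.
  by move=> /(canRL (@invgK _)); rewrite invg1.
- by case=> _ /(_ erefl).
exists M; split=> // [x g h Mg Mh ghN|x].
  apply: contrapT => gh; apply: (Mindep (h * g^-1) (free_shift G g x)) => //.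
    split; first by rewrite /= levelM levelV.
    by move=> /= /(canRL (mulgVK _)); rewrite mul1g => /esym.
  by rewrite actM actK.
have [Mx|[h [hN _] Mhx]] := Mmax x; last by exists h.
by exists 1; rewrite ?level1 ?act1.
Qed.

Variable M : set (free_part G).
Hypothesis M_borel : borel M.
Hypothesis M_separated : separated M.
Hypothesis M_syndetic : syndetic M.

Definition next_marker (r : free_part G) (g : G) : Prop :=
  [/\ (0 < level g)%R, M (free_shift G g r) &
      forall h, M (free_shift G h r) -> (0 < level h)%R -> (level g <= level h)%R].

(* [x] is [g r], where [r] is a marker and [h r] is the first marker above it. *)
Definition position (x : free_part G) (gh : G * G) : Prop :=
  [/\ M (free_shift G gh.1^-1 x), next_marker (free_shift G gh.1^-1 x) gh.2 &
      (0 <= level gh.1 < level gh.2)%R].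

Lemma next_marker_ex r : exists g, next_marker r g.
Proof.
have [t tN] := level_surj level (Posz N.+1).
have [g gN Mg] := M_syndetic (free_shift G t r).
have [||h [h0 Mh] hmin] := @exists_minimum _ level
    [set h | (0 < level h)%R /\ M (free_shift G h r)] 0%R.
- by exists (g * t); split; [rewrite levelM; lia|rewrite actM].
- by move=> h [/ltW].
by exists h; split=> // k Mk k0; apply: hmin.
Qed.

Lemma next_marker_uniq r g h : next_marker r g -> next_marker r h -> g = h.
Proof.
move=> [g0 Mg gmin] [h0 Mh hmin]; apply: (M_separated Mg Mh).
by have := gmin _ Mh h0; have := hmin _ Mg g0; lia.
Qed.

Lemma next_marker_far r g : M r -> next_marker r g -> (Posz N < level g)%R.
Proof.
move=> Mr [g0 Mg _]; rewrite ltNge; apply/negP => gN.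
suff g1 : 1 = g by move: g0; rewrite -g1 level1.
by apply: (@M_separated r); rewrite ?act1 ?level1 //; lia.
Qed.

Lemma next_marker_borel g : borel [set r | next_marker r g].
Proof.
have MgB h : borel [set r | M (free_shift G h r)] by exact: borel_free_shift.
have -> : [set r | next_marker r g] = [set _ | (0 < level g)%R] `&`
    [set r | M (free_shift G g r)] `&`
    \bigcap_(h in [set h | 0 < level h < level g]%R) ~` [set r | M (free_shift G h r)].
  apply/seteqP; split=> [r [g0 Mg gmin]|r [[g0 Mg] gmin]]; split=> //.
    by move=> h /andP[h0 hg] /gmin-/(_ h0); rewrite leNgt hg.
  by move=> h Mh h0; rewrite leNgt; apply/negP => hg; apply: (gmin h) => //=; rewrite h0.
apply: borelI; first by apply: borelI => //; exact: borel_cst.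
apply: borel_bigcap => [|h _]; last exact: borelC.
exact/countable_subset/level_countable.
Qed.

Lemma position_ex x : exists gh, position x gh.
Proof.
have [t tN] := level_surj level (- Posz N)%R.
have [k kN Mk] := M_syndetic (free_shift G t x).
have [||g [g0 Mg] gmin] := @exists_minimum _ level
    [set g | (0 <= level g)%R /\ M (free_shift G g^-1 x)] 0%R.
- by exists (k * t)^-1; split; [rewrite levelV levelM; lia|rewrite invgK actM].
- by move=> h [].
have [h [h0 Mh hmin]] := next_marker_ex (free_shift G g^-1 x).
exists (g, h); split=> //=; rewrite g0 ltNge; apply/negP => hg.
have Mgh : M (free_shift G (g * h^-1)^-1 x) by rewrite invgM invgK actM.
have gh0 : (0 <= level (g * h^-1)%g)%R by rewrite levelM levelV; lia.
by have := gmin _ (conj gh0 Mgh); rewrite levelM levelV; lia.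
Qed.

Lemma position_level_le x gh gh' : position x gh -> position x gh' ->
  (level gh.1 <= level gh'.1)%R.
Proof.
case: gh gh' => [g h] [g' h'] [Mg [_ _ hmin] /andP[_ gh]] [Mg' _ /andP[g'0 _]] /=.
rewrite /= in Mg hmin gh Mg' g'0 *.
rewrite leNgt; apply/negP => gg'.
have := hmin (g'^-1 * g); rewrite -actM mulgK levelM levelV => /(_ Mg').
by lia.
Qed.

Lemma position_uniq x gh gh' : position x gh -> position x gh' -> gh = gh'.
Proof.
move=> xgh xgh'; have levelE : level gh.1 = level gh'.1.
  by apply/le_anti; rewrite !(position_level_le xgh, position_level_le xgh').
case: gh gh' xgh xgh' levelE => [g h] [g' h'] [/= Mg hP _] [/= Mg' hP' _] levelE.
have gg' : g = g'.
  by apply: invg_inj; apply: (M_separated Mg Mg'); rewrite !levelV levelE subrr.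
by rewrite -gg' in hP' *; rewrite (next_marker_uniq hP hP').
Qed.

Lemma position_borel gh : borel [set x | position x gh].
Proof.
have -> : [set x | position x gh] = free_shift G gh.1^-1 @^-1` M `&`
    free_shift G gh.1^-1 @^-1` [set r | next_marker r gh.2] `&`
    [set _ | (0 <= level gh.1 < level gh.2)%R].
  by apply/seteqP; split=> x; [move=> []|move=> [[]]].
apply: borelI; last exact: borel_cst.
by apply: borelI; apply: borel_free_shift => //; exact: next_marker_borel.
Qed.

Lemma position_act x g h s : position x (g, h) -> (0 <= level (s * g)%g < level h)%R ->
  position (free_shift G s x) (s * g, h).
Proof.
by move=> [Mg hP _] sgh; split; rewrite //= ?invgM ?actM ?actK.
Qed.

Lemma position_act_next x g h s : position x (g, h) -> level (s * g) = level h ->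
  exists h', position (free_shift G s x) (s * g * h^-1, h').
Proof.
move=> [_ [_ Mh _] _] sgh.
have hx : free_shift G (s * g * h^-1)^-1 (free_shift G s x) =
    free_shift G h (free_shift G g^-1 x).
  by rewrite invgM invgK actM invgM actM actK.
have [h' h'P] := next_marker_ex (free_shift G h (free_shift G g^-1 x)).
exists h'; split; rewrite /= ?hx //.
by rewrite levelM sgh levelV subrr lexx; case: h'P.
Qed.

End Markers.
End Level.

Section Strips.
Variables (Gam : marked_group) (level : level_map Gam).
Hypothesis level_gens : forall s, gens s -> (`|level s| <= 1)%N.

(* A coloring of the part of the Cayley graph between two consecutive markers [r] and
   [h r], where [g] stands for the point [g r]; on the level of a marker it is the fixed
   coloring [c0], seen from that marker. *)
Definition strip_coloring K (c0 : Gam -> 'I_K) (h : Gam) (psi : Gam -> 'I_K) : Prop :=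
  [/\ forall g, level g = 0%R -> psi g = c0 g,
      forall g, level g = 0%R -> psi (g * h) = c0 g &
      forall g g', (0 <= level g <= level h)%R -> (0 <= level g' <= level h)%R ->
        Cay Gam g g' -> psi g <> psi g'].

Variables (K N : nat) (c0 : Gam -> 'I_K) (psi : Gam -> Gam -> 'I_K).
Hypothesis psiP : forall h, (Posz N < level h)%R -> strip_coloring c0 h (psi h).

Variable M : set (free_part Gam).
Hypothesis M_separated : separated level N M.
Hypothesis M_syndetic : syndetic level N M.

Notation position := (position level M).

Lemma position_strip_coloring x g h :
  position x (g, h) -> strip_coloring c0 h (psi h).
Proof. by move=> [/= Mr hP _]; apply/psiP/(next_marker_far M_separated Mr hP). Qed.

Lemma position_color_act x g h s gh : position x (g, h) ->
  position (free_shift Gam s x) gh -> (0 <= level (s * g)%g <= level h)%R ->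
  psi gh.2 gh.1 = psi h (s * g).
Proof.
move=> xP sxP /andP[sg0]; rewrite le_eqVlt => /predU1P[sgh|sgh].
  have [h' sxP'] := position_act_next M_syndetic xP sgh.
  rewrite (position_uniq M_separated sxP sxP') /=.
  have top : level (s * g * h^-1)%g = 0%R by rewrite levelM levelV sgh subrr.
  have [psi0 _ _] := position_strip_coloring sxP'; rewrite psi0 //.
  by have [_ psih _] := position_strip_coloring xP; rewrite -psih // mulgVK.
have sxP' := position_act xP (introT andP (conj sg0 sgh)).
by rewrite (position_uniq M_separated sxP sxP').
Qed.

Lemma position_color_neq x s gh gh' : gens s -> (0 <= level s)%R -> position x gh ->
  position (free_shift Gam s x) gh' -> psi gh.2 gh.1 <> psi gh'.2 gh'.1.
Proof.
case: gh => g h Ss s0 xP sxP; have [_ _ /= /andP[g0 gh]] := xP.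
have sg : (0 <= level (s * g)%g <= level h)%R.
  by rewrite levelM; have := level_gens Ss; lia.
rewrite (position_color_act xP sxP sg).
have [_ _ psi_neq] := position_strip_coloring xP; apply: psi_neq => //.
  by rewrite g0 ltW.
by apply/CayE; exists s.
Qed.

End Strips.

Theorem strips_borel_colorable (Gam : marked_group) (level : level_map Gam) (K N : nat)
    (c0 : Gam -> 'I_K) :
  (forall s, gens s -> (`|level s| <= 1)%N) ->
  (forall h, (Posz N < level h)%R -> exists psi, strip_coloring level c0 h psi) ->
  borel_colorable (shift_graph Gam) K.
Proof.
move=> level_gens strips.
have /choice[psi psiP] h : exists psi : Gam -> 'I_K,
    (Posz N < level h)%R -> strip_coloring level c0 h psi.
  have [Nh|_] := boolP (Posz N < level h)%R; last by exists c0.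
  by have [psi psiP] := strips h Nh; exists psi.
have [M [M_borel Msep Msyn]] := level_borel_markers level N.
have /choice[pos posP] := position_ex Msyn.
exists (fun x => psi (pos x).2 (pos x).1).
  move=> x y /(free_action_graphE (@free_shift_free Gam))[s Ss sxy].
  have color_neq := position_color_neq level_gens psiP Msep Msyn.
  have [s0|s0] := leP 0%R (level s).
    by apply: color_neq Ss s0 (posP x) _; rewrite sxy; exact: posP.
  apply/nesym; apply: color_neq (gens_sym Ss) _ (posP y) _.
    by rewrite levelV; lia.
  by rewrite -sxy actK; exact: posP.
move=> A; rewrite (_ : _ @^-1` A = \bigcup_gh ([set x | position level M x gh] `&`
    [set _ | A (psi gh.2 gh.1)])).
  apply: borel_bigcup => [|gh _].
    by apply: countable_setTX; exact: level_countable level.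
  by apply: borelI; [exact: position_borel|exact: borel_cst].
apply/seteqP; split=> [x Ax|x [gh _ [xP Ax]]].
  by exists (pos x) => //; split; [exact: posP|].
by rewrite /preimage /mkset (position_uniq Msep (posP x) xP).
Qed.

(** * Recoloring with a spare color *)

Section Recoloring.
Variables A C : finType.
Hypothesis card_lt : (#|A| < #|C|)%N.
Implicit Types f g h : A -> C.

Definition recolors f g : Prop :=
  [/\ injective f, injective g & forall u v, u != v -> f u <> g v].

Fixpoint recoloring L f g : Prop :=
  if L is L'.+1 then exists2 h, recolors f h & recoloring L' h g else f = g.

Lemma recolors_refl f : injective f -> recolors f f.
Proof. by move=> f_inj; split=> // u v /eqP uv /f_inj. Qed.

Lemma recoloring_refl L f : injective f -> recoloring L f f.
Proof. by move=> f_inj; elim: L => //= L IHL; exists f => //; exact: recolors_refl. Qed.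

Lemma recoloring_trans K L f g h :
  recoloring K f g -> recoloring L g h -> recoloring (K + L) f h.
Proof.
elim: K f => [|K IHK] f /=; first by move=> ->.
by move=> [k fk kg] gh; exists k => //; exact: IHK.
Qed.

Lemma recoloring_sequence L f g : injective f -> recoloring L f g ->
  exists ph : nat -> A -> C, [/\ ph 0%N = f, ph L = g,
    forall n, injective (ph n) & forall n, (n < L)%N -> recolors (ph n) (ph n.+1)].
Proof.
elim: L f => [|L IHL] f f_inj /=; first by move=> <-; exists (fun=> f).
move=> [h fh hg]; have [_ h_inj _] := fh.
have [ph [ph0 phL ph_inj phS]] := IHL h h_inj hg.
exists (fun n => if n is n'.+1 then ph n' else f); split=> // [[|n]|[|n]] //.
  by rewrite ph0.
exact: phS.
Qed.

Lemma with_inj f v b : injective f -> (forall u, f u <> b) ->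
  injective [eta f with v |-> b].
Proof.
move=> f_inj fb u w /=; case: eqP => [->|_]; case: eqP => [->|_] //.
- by move=> /esym/fb.
- by move=> /fb.
- exact: f_inj.
Qed.

Lemma recolors_with f v b : injective f -> (forall u, f u <> b) ->
  recolors f [eta f with v |-> b].
Proof.
move=> f_inj fb; split=> // [|u w /eqP uw /=]; first exact: with_inj.
by case: eqP => // _ /f_inj.
Qed.

Lemma exists_spare_color f : injective f -> exists b, forall u, f u <> b.
Proof.
move=> f_inj; have /subsetPn[b _ bf] : ~~ (C \subset codom f).
  by apply: contraL card_lt => /subset_leq_card; rewrite card_codom // -leqNgt.
by exists b => u fu; rewrite -fu codom_f in bf.
Qed.

(* If some [w] already has the color [b], it first moves to a spare color. *)
Lemma recoloring_force (f : A -> C) (v : A) (b : C) : injective f ->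
  exists h, [/\ injective h, recoloring 2 f h, h v = b &
    forall u, u != v -> f u != b -> h u = f u].
Proof.
move=> f_inj; have [[w fw]|nw] := pselect (exists w, f w = b); last first.
  have fb u : f u <> b by move=> fu; apply: nw; exists u.
  exists [eta f with v |-> b]; split=> [|||u /negPf uv _]; rewrite /= ?eqxx ?uv //.
    exact: with_inj.
  exists f; first exact: recolors_refl.
  by exists [eta f with v |-> b] => //; exact: recolors_with.
have [s fs] := exists_spare_color f_inj.
have f'_inj : injective [eta f with w |-> s] by exact: with_inj.
have f'b u : [eta f with w |-> s] u <> b.
  by rewrite /= -fw; case: eqP => [_ /esym/fs|uw /f_inj].
exists [eta [eta f with w |-> s] with v |-> b].
split=> [|||u /negPf uv ub]; rewrite /= ?eqxx ?uv //.
- exact: with_inj.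
- exists [eta f with w |-> s]; first exact: recolors_with.
  by exists [eta [eta f with w |-> s] with v |-> b] => //; exact: recolors_with.
- by case: (u =P w) ub => [->|//]; rewrite fw eqxx.
Qed.

Lemma recoloring_agree f g (s : seq A) : injective f -> injective g -> uniq s ->
  exists h, [/\ injective h, {in s, h =1 g} & recoloring (size s).*2 f h].
Proof.
move=> f_inj g_inj; elim: s => [_|v s IHs /= /andP[vs /IHs[h [h_inj hg fh]]]].
  by exists f.
have [k [k_inj hk kv kh]] := recoloring_force v (g v) h_inj.
exists k; split=> // [u|]; last by have := recoloring_trans fh hk; rewrite addn2.
rewrite inE => /predU1P[-> //|us].
have uv : u != v by apply: contraNneq vs => <-.
by rewrite kh ?hg // (inj_eq g_inj).
Qed.

Lemma recoloring_exists L f g : injective f -> injective g -> (#|A|.*2 <= L)%N ->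
  recoloring L f g.
Proof.
move=> f_inj g_inj AL.
have [h [h_inj hg fh]] := recoloring_agree f_inj g_inj (enum_uniq A).
have -> : g = h by apply/funext => u; rewrite hg // mem_enum.
by rewrite -(subnKC AL) cardE; apply: recoloring_trans fh _; exact: recoloring_refl.
Qed.

End Recoloring.

(** * The two marked groups *)

(* The pair [(i, n)] stands for a^i t^n, where t acts on the additive group of [R] by
   the sign (-1)^e. *)
Definition semidirect (R : nzRingType) (e : bool) : Type := (R * int)%type.

HB.instance Definition _ R e := Choice.on (semidirect R e).

Section SemidirectProduct.
Variables (R : nzRingType) (e : bool).
Notation G := (semidirect R e).
Implicit Types (x y : G) (n : int).

Definition sgn n : R := ((-1) ^+ (e && odd `|n|%N))%R.

Lemma sgn0 : sgn 0 = 1%R.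
Proof. by rewrite /sgn andbF. Qed.

Lemma sgn1 : sgn 1 = ((-1) ^+ e)%R.
Proof. by rewrite /sgn andbT. Qed.

Lemma sgnN n : sgn (- n)%R = sgn n.
Proof. by rewrite /sgn abszN. Qed.

Lemma sgnD n p : sgn (n + p)%R = (sgn n * sgn p)%R.
Proof.
rewrite /sgn -signr_addb -andb_addr; congr (_ ^+ nat_of_bool (_ && _))%R.
by lia.
Qed.

Lemma sgnMK n : involutive ( *%R (sgn n)).
Proof. exact: signrMK. Qed.

Lemma sgnM_inj n : injective ( *%R (sgn n)).
Proof. exact: inv_inj (sgnMK n). Qed.

Definition sd_mul x y : G := (x.1 + sgn x.2 * y.1, x.2 + y.2)%R.
Definition sd_one : G := (0, 0)%R.
Definition sd_inv x : G := (- (sgn x.2 * x.1), - x.2)%R.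

Lemma sd_mulA : associative sd_mul.
Proof. by move=> x y z; rewrite /sd_mul /= sgnD mulrDr mulrA !addrA. Qed.

Lemma sd_mul1g : left_id sd_one sd_mul.
Proof. by case=> i n; rewrite /sd_mul /= sgn0 mul1r !add0r. Qed.

Lemma sd_mulg1 : right_id sd_one sd_mul.
Proof. by case=> i n; rewrite /sd_mul /= mulr0 !addr0. Qed.

Lemma sd_mulVg : left_inverse sd_one sd_inv sd_mul.
Proof. by case=> i n; rewrite /sd_mul /= sgnN !addNr. Qed.

Lemma sd_mulgV : right_inverse sd_one sd_inv sd_mul.
Proof. by case=> i n; rewrite /sd_mul /= mulrN sgnMK !addrN. Qed.

HB.instance Definition _ :=
  isGroup.Build G sd_mulA sd_mul1g sd_mulg1 sd_mulVg sd_mulgV.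

Lemma sd_mulE x y : x * y = (x.1 + sgn x.2 * y.1, x.2 + y.2)%R :> G.
Proof. by []. Qed.

Lemma sd_invE x : x^-1 = (- (sgn x.2 * x.1), - x.2)%R :> G.
Proof. by []. Qed.

Definition sd_t : G := (0, 1)%R.

Lemma sd_t_expE (n : nat) : sd_t ^+ n = (0%R, Posz n) :> G.
Proof.
elim: n => [//|n IHn]; rewrite expgS IHn sd_mulE /= mulr0 addr0.
by congr pair; lia.
Qed.

Lemma sd_t_infinite_order : infinite_order sd_t.
Proof. by move=> n p; rewrite !sd_t_expE => -[]. Qed.

(* [rises 1 s] holds for s = a^i with i <> 0 and for s = a^i t with i <> 0, 1. *)
Definition rises x y : Prop :=
  (y.2 = x.2 /\ y.1 != x.1) \/
  (y.2 = (x.2 + 1)%R /\ (y.1 - sgn 1 * x.1)%R \notin [:: 0; 1]%R).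

Lemma rises_mulr x y g : rises x y -> rises (x * g) (y * g).
Proof.
move=> [[yx xy]|[yx xy]]; [left|right]; rewrite !sd_mulE /= yx.
  by rewrite (inj_eq (addIr _)).
rewrite addrAC; split=> //; rewrite (addrC x.2) sgnD mulrDr -mulrA.
by rewrite opprD addrACA addrN addr0.
Qed.

Lemma rises_irr x : ~ rises x x.
Proof. by move=> [[_ /eqP]|[xx _]] //; lia. Qed.

Definition sd_gens : set G := [set s | rises 1 s \/ rises s 1].

Lemma sd_gens_sym s : sd_gens s -> sd_gens s^-1.
Proof. by case=> /(rises_mulr s^-1); rewrite mul1g mulgV; [right|left]. Qed.

Lemma sd_gens_neq1 : ~ sd_gens 1.
Proof. by case=> /rises_irr. Qed.

Lemma sd_gens_level s : sd_gens s -> (`|s.2| <= 1)%N.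
Proof. by rewrite /sd_gens /rises /= => -[] [[]|[]]; lia. Qed.

Lemma sd_gens_left_mulE x y :
  (exists2 s, sd_gens s & s * x = y) <-> rises x y \/ rises y x.
Proof.
split=> [[s Ss <-]|xy].
  by case: Ss => /(rises_mulr x); rewrite mul1g; [left|right].
exists (y * x^-1); last exact: mulgVK.
by case: xy => /(rises_mulr x^-1); rewrite mulgV; [left|right].
Qed.

End SemidirectProduct.

Lemma sgn_untwisted (R : nzRingType) n : sgn R false n = 1%R.
Proof. by []. Qed.

Section FiniteSemidirectProduct.
Variables (R : finNzRingType) (e : bool).
Notation G := (semidirect R e).

Definition sd_level (x : G) : int := x.2.

Lemma sd_levelM : {morph sd_level : x y / x * y >-> (x + y)%R}.
Proof. by []. Qed.

Lemma sd_level_surj n : exists x, sd_level x = n.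
Proof. by exists (0%R, n). Qed.

Lemma sd_level_kernel_finite : finite_set [set x | sd_level x = 0%R].
Proof.
apply: (@sub_finite_set _ _ (range (fun i : R => (i, 0%R) : G))).
  by move=> [i n] /= ->; exists i.
exact/finite_image/finite_finset.
Qed.

Definition sd_level_map : level_map G :=
  LevelMap sd_levelM sd_level_surj sd_level_kernel_finite.

Lemma sd_free_part_nonempty : inhabited (free_part G).
Proof.
apply: free_part_nonempty; last exact: level_countable sd_level_map.
exact: infinite_order_infinite_set (@sd_t_infinite_order R e).
Qed.

Lemma sd_gens_finite : finite_set (@sd_gens R e).
Proof.
exact: sub_finite_set (@sd_gens_level R e) (level_ball_finite sd_level_map 1).
Qed.

End FiniteSemidirectProduct.

Section MarkedSemidirectProduct.
Variables (m : nat) (e : bool).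
Notation Z := 'I_m.+3.
Notation G := (semidirect Z e).

Lemma sd_gens_generate (H : {pred G}) : group_closed H ->
  @sd_gens Z e `<=` [set` H] -> forall g, g \in H.
Proof.
move=> [H_one H_div] gens_H.
have H_inv x : x \in H -> x^-1 \in H by move=> xH; rewrite -[x^-1]mul1g; exact: H_div.
have H_mul x y : x \in H -> y \in H -> x * y \in H.
  by move=> xH yH; rewrite -[y]invgK; apply: H_div => //; exact: H_inv.
have H_a (i : Z) : ((i, 0%R) : G) \in H.
  have [->|i0] := eqVneq i 0%R; first exact: H_one.
  by apply: gens_H; left; left.
have H_t : (sd_t Z e) \in H.
  have -> : sd_t Z e = ((- (1 + 1), 0)%R : G) * ((1 + 1, 1)%R : G).
    by rewrite sd_mulE sgn0 mul1r addNr add0r.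
  by apply: H_mul => //; apply: gens_H; left; right; split; rewrite //= mulr0 subr0.
have H_tX (n : nat) : sd_t Z e ^+ n \in H.
  by elim: n => [|n IHn]; [exact: H_one|rewrite expgS; exact: H_mul].
have H_tXz n : ((0, n)%R : G) \in H.
  case: n => n; first by rewrite -[(0, _)%R](@sd_t_expE Z e).
  have -> : (0, Negz n)%R = (sd_t Z e ^+ n.+1)^-1.
    by rewrite sd_t_expE sd_invE /= mulr0 oppr0.
  exact/H_inv/H_tX.
case=> i n; have -> : ((i, n) : G) = ((i, 0%R) : G) * ((0%R, n) : G).
  by rewrite sd_mulE mulr0 addr0 add0r.
exact: H_mul.
Qed.

Definition sd_marked : marked_group := MarkedGroup
  (@sd_gens_finite Z e) (@sd_gens_sym Z e) (@sd_gens_neq1 Z e) sd_gens_generate.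

Lemma sd_CayE x y : Cay sd_marked x y <-> rises x y \/ rises y x.
Proof. by rewrite CayE -sd_gens_left_mulE. Qed.

End MarkedSemidirectProduct.

(** * Colorings of the Cayley graphs *)

Section Untwist.
Variable R : nzRingType.

(* Chosen so that consecutive values sum to [1] at even [n] and to [0] at odd [n],
   which aligns the non-edges between levels [n] and [n + 1] of the two graphs. *)
Definition untwist_offset (n : int) : R :=
  if odd `|n|%N then ((n %/ 2)%Z + 1)%R%:~R%R else (- (n %/ 2)%Z%:~R)%R.

Lemma untwist_offset_consecutive (n : int) :
  (untwist_offset (n + 1)%R + untwist_offset n)%R = if odd `|n|%N then 0%R else 1%R.
Proof.
rewrite /untwist_offset; have -> : odd `|(n + 1)%R|%N = ~~ odd `|n|%N by lia.
case: (boolP (odd _)) => on /=.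
  have -> : ((n + 1)%R %/ 2)%Z = ((n %/ 2)%Z + 1)%R by lia.
  by rewrite addNr.
have -> : ((n + 1)%R %/ 2)%Z = (n %/ 2)%Z by lia.
by rewrite intrD addrAC subrr add0r.
Qed.

Definition sd_untwist (x : semidirect R false) : semidirect R true :=
  (sgn R true x.2 * x.1 + untwist_offset x.2, x.2)%R.

Lemma sd_untwist_bij : bijective sd_untwist.
Proof.
exists (fun x => (sgn R true x.2 * (x.1 - untwist_offset x.2), x.2)%R) => -[i n];
  rewrite /sd_untwist /=; first by rewrite addrK sgnMK.
by rewrite sgnMK subrK.
Qed.

Lemma sd_untwist_next_level (i j : R) (n : int) :
  ((sd_untwist (j, n + 1)).1 - sgn R true 1 * (sd_untwist (i, n)).1)%R =
  (if odd `|n|%N then j - i else 1 - (j - i))%R.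
Proof.
rewrite /= sgn1 mulN1r opprK addrACA untwist_offset_consecutive sgnD sgn1 mulrN1 mulNr.
rewrite /sgn; case: (odd _); first by rewrite addr0 mulN1r opprK mulN1r.
by rewrite !mul1r addrC opprB [(- j + i)%R]addrC.
Qed.

Lemma subr1_notin01 (d : R) : ((1 - d)%R \notin [:: 0; 1]%R) = (d \notin [:: 0; 1]%R).
Proof.
rewrite !inE subr_eq0 (eq_sym 1%R d) orbC; congr (~~ (_ || _)).
by rewrite -[RHS]oppr_eq0 -(inj_eq (addrI 1%R) (- d)%R) addr0.
Qed.

Lemma rises_untwist x y : rises (sd_untwist x) (sd_untwist y) <-> rises x y.
Proof.
case: x y => [i n] [j p]; rewrite /rises.
have [-> | pn] := eqVneq p n.
  rewrite /= (inj_eq (addIr _)) (inj_eq (@sgnM_inj _ _ _)).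
  by split=> -[[]|[]]; [left|lia|left|lia].
have [-> | pn1] := eqVneq p (n + 1)%R; last first.
  by split=> -[[]|[]] /= /eqP; rewrite ?(negPf pn) ?(negPf pn1).
rewrite sd_untwist_next_level /= sgn_untwisted mul1r.
case: (odd _); rewrite ?subr1_notin01; split=> -[[]|[]]; by [lia|right].
Qed.

End Untwist.

Lemma sd_Cay_iso m : graph_iso (Cay (sd_marked m false)) (Cay (sd_marked m true)).
Proof.
exists (@sd_untwist 'I_m.+3) => [|x y]; first exact: sd_untwist_bij.
by rewrite !sd_CayE !rises_untwist.
Qed.

Section LevelColors.
Variables (m : nat) (e : bool) (K : nat) (c : sd_marked m e -> 'I_K).
Hypothesis cP : coloring (Cay (sd_marked m e)) c.
Notation Z := 'I_m.+3.

Lemma rises_color_neq x y : rises x y -> c x <> c y.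
Proof. by move=> xy; apply: cP; apply/sd_CayE; left. Qed.

Lemma level_color_inj n : injective (fun i : Z => c (i, n)).
Proof.
move=> i j /= cij; apply/eqP; apply: contraPT cij => ij.
by apply: rises_color_neq; left; rewrite eq_sym.
Qed.

End LevelColors.

Lemma untwisted_Cay_colorable m : colorable (Cay (sd_marked m false)) m.+3.
Proof.
exists (fun x => x.1) => x y; rewrite sd_CayE.
have rises_neq (u v : semidirect 'I_m.+3 false) : rises u v -> u.1 <> v.1.
  move=> [[_ /eqP/nesym//]|[_]].
  rewrite sgn_untwisted mul1r !inE negb_or => /andP[uv _] uv1.
  by rewrite uv1 subrr eqxx in uv.
by move=> [/rises_neq|/rises_neq/nesym].
Qed.

Lemma sd_Cay_chromatic_number m e : chromatic_number (Cay (sd_marked m e)) m.+3.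
Proof.
have chi_untwisted : chromatic_number (Cay (sd_marked m false)) m.+3.
  split=> [|k [c cP]]; first exact: untwisted_Cay_colorable.
  by have /leq_card := level_color_inj cP (n := 0%R); rewrite !card_ord.
by case: e => //; exact: graph_iso_chromatic_number (sd_Cay_iso m) _.
Qed.

Lemma sd_shift_chromatic_number m e : chromatic_number (shift_graph (sd_marked m e)) m.+3.
Proof.
apply: free_action_chromatic_number; first exact: free_shift_free.
  exact: sd_free_part_nonempty.
exact: sd_Cay_chromatic_number.
Qed.

(** * Cyclic orders *)

Section CyclicOrders.
Variable m : nat.
Notation Z := 'I_m.+3.

Lemma two_choices_reflection (C : Type) (f g : Z -> C) : injective f ->
  (forall i, f i = g (- i)%R \/ f i = g (1 - i)%R) ->
  exists r, forall i, g i = f (r - i)%R.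
Proof.
move=> f_inj fg; suff [r fr] : exists r, forall i, f i = g (r - i)%R.
  by exists r => i; rewrite fr subKr.
have [[i0 fi0]|no0] := pselect (exists i, f i = g (- i)%R); last first.
  by exists 1%R => i; case: (fg i) => // fi; case: no0; exists i.
exists 0%R => i; rewrite sub0r.
have f_add (k : nat) : f (i0 + k%:R)%R = g (- (i0 + k%:R))%R.
  elim: k => [|k IHk]; first by rewrite addr0.
  have [//|] := fg (i0 + k.+1%:R)%R.
  have -> : (1 - (i0 + k.+1%:R))%R = (- (i0 + k%:R))%R :> Z by rewrite -natr1; ring.
  rewrite -IHk => /f_inj/addrI/eqP.
  by rewrite -natr1 -subr_eq0 addrAC subrr add0r oner_eq0.
by have := f_add (i - i0)%R; rewrite natr_Zp addrC subrK.
Qed.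

(* The orientation of the cyclic order in which [f] lists the colors, read off the two
   neighbors of the color [0]. *)
Definition clockwise (f : Z -> Z) : Prop :=
  exists i, f i = 0%R /\ (f (i + 1)%R < f (i - 1)%R)%N.

Lemma clockwiseE (f : Z -> Z) i : injective f -> f i = 0%R ->
  clockwise f <-> (f (i + 1)%R < f (i - 1)%R)%N.
Proof.
by move=> f_inj fi; split=> [[j []]|lt]; [rewrite -fi => /f_inj ->|exists i].
Qed.

Lemma clockwise_reflection (f g : Z -> Z) r : injective f ->
  (forall i, g i = f (r - i)%R) -> clockwise g <-> ~ clockwise f.
Proof.
move=> f_inj gf; have [f' _ f'K] := injF_bij f_inj.
pose i := f' 0%R; have fi : f i = 0%R by exact: f'K.
have g_inj : injective g by move=> j k; rewrite !gf => /f_inj/subrI.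
rewrite (clockwiseE f_inj fi) (@clockwiseE g (r - i)%R g_inj); last by rewrite gf subKr.
have -> : g (r - i + 1)%R = f (i - 1)%R by rewrite gf; congr f; ring.
have -> : g (r - i - 1)%R = f (i + 1)%R by rewrite gf; congr f; ring.
have f_neq : f (i - 1)%R != f (i + 1)%R :> nat.
  apply/eqP => /val_inj/f_inj/addrI/eqP.
  by rewrite -subr_eq0 -opprD oppr_eq0.
by rewrite ltn_neqAle f_neq /= leqNgt; split => /negP.
Qed.

End CyclicOrders.

(** * Borel colorings *)

Lemma borel_map_family_preimage (T : topologicalType) (I : finType) K (f : I -> T -> 'I_K)
    (P : set (I -> 'I_K)) :
  (forall i, borel_map (f i)) -> borel [set x | P (f^~ x)].
Proof.
move=> bf; rewrite (_ : mkset _ = \bigcup_(v in [set v : {ffun I -> 'I_K} | P v])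
    \bigcap_i (f i @^-1` [set v i])).
  apply: borel_bigcup => [|v _]; first exact: countableP.
  by apply: borel_bigcap => [|i _]; [exact: countableP|exact: bf].
apply/seteqP; split=> [x Px|x [v Pv xv]].
  exists [ffun i => f i x] => [|i _]; last by rewrite /= ffunE.
  by rewrite /= (_ : fun_of_fin _ = f^~ x) //; apply/funext => i; rewrite ffunE.
by rewrite /= (_ : f^~ x = v) //; apply/funext => i; exact: xv.
Qed.

Section TwistedLowerBound.
Variable m : nat.
Notation Z := 'I_m.+3.
Notation G := (sd_marked m true).
Notation t := (sd_t Z true).

Lemma Cay_coloring_reflected (c : G -> Z) : coloring (Cay G) c ->
  exists r, forall i, c (i, 1%R) = c ((r - i)%R, 0%R).
Proof.
move=> cP; apply: (two_choices_reflection (level_color_inj cP (n := 0%R))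
  (g := fun i => c (i, 1%R))) => i.
have [c1' _ c1K] := injF_bij (level_color_inj cP (n := 1%R)).
pose j := c1' (c (i, 0%R)); have cj : c (j, 1%R) = c (i, 0%R) by exact: c1K.
have : (j + i)%R \in [:: 0; 1]%R.
  apply: contraPT cj => ji; apply/nesym; apply: (rises_color_neq cP); right.
  by rewrite /= sgn1 mulN1r opprK.
rewrite !inE addr_eq0 => /orP[/eqP ji|/eqP ji]; [left|right]; rewrite -cj.
  by rewrite ji.
by rewrite -ji addrK.
Qed.

Lemma twisted_not_borel_colorable : ~ borel_colorable (shift_graph G) m.+3.
Proof.
move=> [c cP bc]; pose f x (i : Z) := c (free_shift G (i, 0%R) x).
have cxP x : coloring (Cay G) (fun g => c (free_shift G g x)).
  exact: (free_action_coloring (@free_shift_free G) cP).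
apply: (@infinite_order_borel_not_flipped G t (level_countable (sd_level_map Z true))
  (@sd_t_infinite_order Z true) [set x | clockwise (f x)]).
  by apply: borel_map_family_preimage => i A; exact: borel_free_shift (bc A).
move=> x; have [r fr] := Cay_coloring_reflected (cxP x).
apply: (clockwise_reflection (level_color_inj (cxP x) (n := 0%R)) (r := r)) => i.
by rewrite -fr /f -actM sd_mulE /= mulr0 addr0 add0r.
Qed.

End TwistedLowerBound.

Lemma sd_strip_coloring m e K (c0 : sd_marked m e -> 'I_K) (h : sd_marked m e)
    (psi : sd_marked m e -> 'I_K) :
  (forall i : 'I_m.+3, psi (i, 0%R) = c0 (i, 0%R)) ->
  (forall i : 'I_m.+3, psi (((i, 0%R) : sd_marked m e) * h) = c0 (i, 0%R)) ->
  (forall x y : sd_marked m e, (0 <= x.2)%R -> (y.2 <= h.2)%R ->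
    rises x y -> psi x <> psi y) ->
  strip_coloring (Gam := sd_marked m e) (sd_level_map _ e) c0 h psi.
Proof.
move=> psi0 psih psi_rises; split=> [[i n] /= ->|[i n] /= ->|x y] //.
move=> /andP[x0 xh] /andP[y0 yh] /sd_CayE[|/psi_rises] xy; first exact: psi_rises.
exact/nesym/xy.
Qed.

Lemma untwisted_borel_colorable m :
  borel_colorable (shift_graph (sd_marked m false)) m.+3.
Proof.
apply: (@strips_borel_colorable (sd_marked m false) (sd_level_map _ false) _ m.+3
  (fun x => x.1)).
  exact: sd_gens_level.
move=> [h1 L] /= hL; exists (fun x => x.1 - (minn `|x.2| h1)%:R)%R.
apply: sd_strip_coloring => [i|i|[i n] [j p] /= n0 pL].
- by rewrite min0n subr0.
- rewrite /= sgn0 mul1r add0r (_ : minn _ _ = h1); last by have := ltn_ord h1; lia.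
  by rewrite natr_Zp addrK.
- case=> [[/= -> ji]|[/= pn]]; first by move=> /addIr ij; rewrite ij eqxx in ji.
  rewrite sgn_untwisted mul1r !inE negb_or subr_eq0 => /andP[/eqP ji0 /eqP ji1].
  have [nh|nh] := leqP h1 `|n|.
    by rewrite !(minn_idPr _) //; [move=> /addIr/esym|lia].
  rewrite (_ : minn `|p| h1 = `|n|.+1); last by lia.
  set q : 'I_m.+3 := `|n|%:R%R; rewrite -natr1 -/q => ij; apply: ji1.
  by rewrite (_ : j - i = (j - (q + 1)) - (i - q) + 1)%R; [rewrite ij subrr add0r|ring].
Qed.

Lemma spare_color_borel_colorable m e :
  borel_colorable (shift_graph (sd_marked m e)) m.+4.
Proof.
pose c0 : 'I_m.+3 -> 'I_m.+4 := widen_ord (leqnSn m.+3).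
have c0_inj : injective c0 by move=> i j [] ij; exact: val_inj.
apply: (@strips_borel_colorable (sd_marked m e) (sd_level_map _ e) _ (m.+3).*2
  (fun x => c0 x.1)).
  exact: sd_gens_level.
move=> [h1 L] /= hL.
have c1_inj : injective (fun i => c0 (sgn _ e L * i - h1)%R).
  by move=> i j /c0_inj/addIr/sgnM_inj.
have card_lt : (#|'I_m.+3| < #|'I_m.+4|)%N by rewrite !card_ord.
have [|ph [ph0 phL ph_inj phS]] := recoloring_sequence c0_inj
    (recoloring_exists card_lt c0_inj c1_inj (L := `|L|) _).
  by rewrite card_ord; lia.
exists (fun x => ph `|x.2|%N (sgn _ e x.2 * x.1)%R).
apply: sd_strip_coloring => [i|i|[i n] [j p] /= n0 pL].
- by rewrite /= sgn0 mul1r ph0.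
- by rewrite /= sgn0 mul1r add0r phL sgnMK addrK.
- case=> [[/= -> ji]|[/= pn]].
    by move=> /ph_inj/sgnM_inj ij; rewrite ij eqxx in ji.
  rewrite !inE negb_or subr_eq0 => /andP[ji _].
  have [|_ _] := phS `|n|%N; first by lia.
  rewrite (_ : `|n|.+1 = `|p|)%N; last by lia.
  apply; rewrite pn sgnD -mulrA (inj_eq (@sgnM_inj _ _ _)).
  by apply: contraNneq ji => ->; rewrite sgnMK.
Qed.

Lemma untwisted_borel_chromatic_number m :
  borel_chromatic_number (shift_graph (sd_marked m false)) m.+3.
Proof.
split=> [|j /borel_colorableW]; first exact: untwisted_borel_colorable.
by have [_ shift_min] := sd_shift_chromatic_number m false; exact: shift_min.
Qed.

Lemma twisted_borel_chromatic_number m :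
  borel_chromatic_number (shift_graph (sd_marked m true)) m.+4.
Proof.
split=> [|j bj]; first exact: spare_color_borel_colorable.
have [_ /(_ j (borel_colorableW bj))] := sd_shift_chromatic_number m true.
rewrite leq_eqVlt => /predU1P[jm|//].
by move: bj; rewrite -jm => /twisted_not_borel_colorable.
Qed.

Theorem theorem1 (k : nat) (hk : 3 <= k) :
  exists Gam Del : marked_group,
    [/\ graph_iso (Cay Gam) (Cay Del),
        [/\ borel_chromatic_number (shift_graph Gam) k,
            chromatic_number (shift_graph Gam) k,
            chromatic_number (shift_graph Del) k,
            chromatic_number (Cay Gam) k
          & chromatic_number (Cay Del) k]
      & borel_chromatic_number (shift_graph Del) k.+1].
Proof.
case: k hk => [|[|[|m]]] // _; exists (sd_marked m false), (sd_marked m true).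
split; [exact: sd_Cay_iso|split|exact: twisted_borel_chromatic_number].
- exact: untwisted_borel_chromatic_number.
- exact: sd_shift_chromatic_number.
- exact: sd_shift_chromatic_number.
- exact: sd_Cay_chromatic_number.
- exact: sd_Cay_chromatic_number.
Qed.
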